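(* A nontrivially valued field of positive characteristic whose underlying field is definable in an NTP$_2$ theory is a semitame field.
   Context: NTP$_2$: Let $T$ be a complete first order theory. A formula $\varphi(x,y)$ has the tree property of the second kind (TP$_2$) with respect to $T$ if in some model of $T$ there are an array of parameters $(a_{i,j})_{i,j\in\mathbb{N}}$ and an integer $k\geq 2$ such that for each $i$ the set $\{\varphi(x,a_{i,j})\mid j\in\mathbb{N}\}$ is $k$-inconsistent (every subset of size $k$ is inconsistent), while for each function $f:\mathbb{N}\to\mathbb{N}$ the set $\{\varphi(x,a_{i,f(i)})\mid i\in\mathbb{N}\}$ is consistent. $T$ is NTP$_2$ if no formula has TP$_2$. A field is definable in an NTP$_2$ theory if it is definable (underlying set and field operations) in some model of an NTP$_2$ theory. Valuations are Krull valuations of arbitrary rank, written additively; $vK$ is the value group and $Kv$ the residue field of $(K,v)$. A valued field $(K,v)$ is called semitame if either $\mathrm{char}\,Kv=0$, or $\mathrm{char}\,Kv=p>0$ and the following two axioms hold: (DRst) the value group $vK$ is $p$-divisible; (DRvr) the homomorphism $\mathcal{O}_{K^c}/p\mathcal{O}_{K^c}\to \mathcal{O}_{K^c}/p\mathcal{O}_{K^c}$, $x\mapsto x^p$, is surjective, where $\mathcal{O}_{K^c}$ denotes the valuation ring of the completion $K^c$ of $(K,v)$. *)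

(* Defs.v *)
From HB Require Import structures.
From mathcomp Require Import all_boot all_order all_algebra.
From mathcomp Require Import ring_quotient.
From mathcomp Require Import mathcomp_extra boolp classical_sets filter.

Set Implicit Arguments.
Unset Strict Implicit.
Unset Printing Implicit Defensive.

Import Order.TTheory GRing.Theory.
Local Open Scope ring_scope.
Local Open Scope quotient_scope.
Local Open Scope classical_set_scope.

Record language := Language {
  fsymb : Type;
  fsymb_arity : fsymb -> nat;
  rsymb : Type;
  rsymb_arity : rsymb -> nat }.

Section Syntax.
Variable L : language.

Inductive fo_term (n : nat) : Type :=
| TVar of 'I_n
| TApp (f : fsymb L) of ('I_(fsymb_arity f) -> fo_term n).

(* Formulas with free variables among v_0, ..., v_(n-1). In [FAll phi] the
   variable v_0 of phi is bound and v_(j+1) stands for the outer v_j. *)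
Inductive fo_formula : nat -> Type :=
| FFalse n : fo_formula n
| FEq n : fo_term n -> fo_term n -> fo_formula n
| FRel n (r : rsymb L) : ('I_(rsymb_arity r) -> fo_term n) -> fo_formula n
| FImp n : fo_formula n -> fo_formula n -> fo_formula n
| FAll n : fo_formula n.+1 -> fo_formula n.

Definition sentence := fo_formula 0.
Definition theory := set sentence.

Record fo_structure := FoStructure {
  carrier :> Type;
  carrier_nonempty : inhabited carrier;
  finterp (f : fsymb L) : ('I_(fsymb_arity f) -> carrier) -> carrier;
  rinterp (r : rsymb L) : ('I_(rsymb_arity r) -> carrier) -> Prop }.

End Syntax.

Definition env0 (M : Type) (i : 'I_0) : M :=
  match notF (ltn_ord i) with end.

Definition env_cons (M : Type) n (x : M) (e : 'I_n -> M) (i : 'I_n.+1) : M :=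
  if unlift ord0 i is Some j then e j else x.

Definition env_cat (M : Type) m n (a : 'I_m -> M) (b : 'I_n -> M)
    (i : 'I_(m + n)) : M :=
  match split i with inl j => a j | inr j => b j end.

Section Semantics.
Variable L : language.

Fixpoint teval (M : fo_structure L) n (e : 'I_n -> M) (t : fo_term L n) : M :=
  match t with
  | TVar v => e v
  | TApp f ts => finterp (fun i => teval e (ts i))
  end.

Fixpoint sat (M : fo_structure L) n (phi : fo_formula L n) :
    ('I_n -> M) -> Prop :=
  match phi in fo_formula _ n return ('I_n -> M) -> Prop with
  | FFalse _ => fun=> False
  | FEq _ t u => fun e => teval e t = teval e u
  | FRel _ r ts => fun e => rinterp (fun i => teval e (ts i))
  | FImp _ phi psi => fun e => sat phi e -> sat psi e
  | FAll _ phi => fun e => forall x : M, sat phi (env_cons x e)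
  end.

Definition models (M : fo_structure L) (T : theory L) : Prop :=
  forall s, T s -> sat s (@env0 M).

Definition entails (T : theory L) (s : sentence L) : Prop :=
  forall M : fo_structure L, models M T -> sat s (@env0 M).

Definition complete_theory (T : theory L) : Prop :=
  (exists M : fo_structure L, models M T) /\
  forall s, entails T s \/ entails T (FImp s (FFalse L 0)).

Definition elementary_embedding (M N : fo_structure L) (e : M -> N) : Prop :=
  forall n (phi : fo_formula L n) (a : 'I_n -> M),
    sat phi a <-> sat phi (e \o a).

(* For phi(x,y) with |x| = m and |y| = n: the set of formulas phi(x,a), a in A,
   is consistent with the elementary diagram of M. *)
Definition consistent (M : fo_structure L) m n (phi : fo_formula L (m + n))
    (A : set ('I_n -> M)) : Prop :=
  exists (N : fo_structure L) (e : M -> N) (c : 'I_m -> N),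
    elementary_embedding e /\ forall a, A a -> sat phi (env_cat c (e \o a)).

(* The rows (phi(x,a_{i,j}))_j are families indexed by j: k-inconsistency is
   about any k distinct indices, even if the parameters a_{i,j} repeat. *)
Definition TP2 (T : theory L) m n (phi : fo_formula L (m + n)) : Prop :=
  exists (M : fo_structure L) (a : nat -> nat -> ('I_n -> M)) (k : nat),
    [/\ models M T, (2 <= k)%N,
        forall (i : nat) (J : 'I_k -> nat), injective J ->
          ~ consistent phi (range (a i \o J)) &
        forall f : nat -> nat, consistent phi (range (fun i => a i (f i)))].

Definition NTP2 (T : theory L) : Prop :=
  forall m n (phi : fo_formula L (m + n)), ~ TP2 T phi.

(* Definability is with parameters. *)
Definition definable_set (M : fo_structure L) n (X : set ('I_n -> M)) : Prop :=
  exists m (phi : fo_formula L (n + m)) (b : 'I_m -> M),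
    forall c, X c <-> sat phi (env_cat c b).

(* K is, up to the bijection h, a definable subset of some M^n on which the
   graphs of addition and multiplication are definable. *)
Definition definable_field (M : fo_structure L) (K : fieldType) : Prop :=
  exists n (h : K -> ('I_n -> M)),
    [/\ injective h,
        definable_set (range h),
        definable_set [set c | exists x y,
          c = env_cat (env_cat (h x) (h y)) (h (x + y))] &
        definable_set [set c | exists x y,
          c = env_cat (env_cat (h x) (h y)) (h (x * y))]].

End Semantics.

Definition definable_in_NTP2 (K : fieldType) : Prop :=
  exists (L : language) (T : theory L),
    [/\ complete_theory T, NTP2 T &
        exists M : fo_structure L, models M T /\ definable_field M K].

HB.mixin Record isOrderedAbelianGroup G of Num.POrderedZmodule G := {
  oag_le_total : total (<=%R : rel G);
  oag_leD2l : forall x y z : G, x <= y -> z + x <= z + y }.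

#[short(type="oagType")]
HB.structure Definition OrderedAbelianGroup :=
  {G of isOrderedAbelianGroup G & Num.POrderedZmodule G}.

(* A Krull valuation with value group G; v 0 is a junk value, the convention
   v 0 = oo being built into [vge] and [vgt] below. *)
Record valuation (K : fieldType) (G : oagType) := Valuation {
  vfun :> K -> G;
  v_onto : forall g, exists2 x, x != 0 & vfun x = g;
  v_mul : forall x y, x != 0 -> y != 0 -> vfun (x * y) = vfun x + vfun y;
  v_add : forall x y, x != 0 -> y != 0 -> x + y != 0 ->
    Order.min (vfun x) (vfun y) <= vfun (x + y) }.

Section ValuationRing.
Variables (K : fieldType) (G : oagType) (v : valuation K G).

Definition nontrivial_valuation : Prop := exists2 x, x != 0 & v x != 0.

Definition vge (g : G) (x : K) : bool := (x == 0) || (g <= v x).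
Definition vgt (g : G) (x : K) : bool := (x == 0) || (g < v x).

Definition in_vring : {pred K} := vge 0.

Lemma in_vringE x : (x \in in_vring) = (x == 0) || (0 <= v x).
Proof. by []. Qed.

Lemma v1 : v 1 = 0.
Proof.
have := v_mul v (oner_neq0 K) (oner_neq0 K).
by rewrite mulr1 -{1}[v 1]addr0 => /addrI.
Qed.

Lemma vN x : v (- x) = v x.
Proof.
have [->|x0] := eqVneq x 0; first by rewrite oppr0.
have N1 : (-1 : K) != 0 by rewrite oppr_eq0 oner_neq0.
have e : v (-1) + v (-1) = 0 by rewrite -v_mul // mulrNN mulr1 v1.
suff -> : v (- x) = v (-1) + v x.
  suff -> : v (-1) = 0 by rewrite add0r.
  apply/eqP; rewrite eq_le; apply/andP; split.
  - case/orP: (oag_le_total (v (-1)) 0) => // h.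
    by have := oag_leD2l _ _ (v (-1)) h; rewrite e addr0.
  - case/orP: (oag_le_total 0 (v (-1))) => // h.
    by have := oag_leD2l _ _ (v (-1)) h; rewrite e addr0.
by rewrite -v_mul // mulN1r.
Qed.

Lemma vgeD g x y : vge g x -> vge g y -> vge g (x + y).
Proof.
rewrite /vge; have [->|x0] := eqVneq x 0; first by rewrite add0r.
have [->|y0] := eqVneq y 0; first by rewrite addr0 (negPf x0).
move=> /= gx gy; have [//|s0] := eqVneq (x + y) 0; rewrite ?orTb ?orFb.
by apply: le_trans (v_add v x0 y0 s0); rewrite /Order.min; case: ifP.
Qed.

Lemma vgtD g x y : vgt g x -> vgt g y -> vgt g (x + y).
Proof.
rewrite /vgt; have [->|x0] := eqVneq x 0; first by rewrite add0r.
have [->|y0] := eqVneq y 0; first by rewrite addr0 (negPf x0).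
move=> /= gx gy; have [//|s0] := eqVneq (x + y) 0; rewrite ?orTb ?orFb.
by apply: lt_le_trans (v_add v x0 y0 s0); rewrite /Order.min; case: ifP.
Qed.

Lemma in_vring_closed : subring_closed in_vring.
Proof.
split; rewrite /in_vring /in_mem /=; first by rewrite /vge v1 lexx orbT.
- move=> x y xO yO; apply: vgeD => //.
  by move: yO; rewrite /in_mem /= /vge oppr_eq0 vN.
- move=> x y; rewrite /in_mem /= /vge.
  have [->|x0] := eqVneq x 0; first by rewrite mul0r eqxx.
  have [->|y0] := eqVneq y 0; first by rewrite mulr0 eqxx.
  move=> /= x1 y1; rewrite v_mul //; apply/orP; right.
  by apply: le_trans x1 _; rewrite -[leLHS]addr0; apply: oag_leD2l.
Qed.

HB.instance Definition _ :=
  GRing.isSubringClosed.Build K in_vring in_vring_closed.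

Record vring := VRing { vring_val :> K; _ : vring_val \in in_vring }.

HB.instance Definition _ := [isSub for vring_val].
HB.instance Definition _ := [Choice of vring by <:].
HB.instance Definition _ := [SubChoice_isSubComNzRing of vring by <:].

Definition in_vmax : {pred vring} := fun x => vgt 0 (val x).

Lemma in_vmaxE (x : vring) : (x \in in_vmax) = (val x == 0) || (0 < v (val x)).
Proof. by []. Qed.

Lemma in_vmax_closed : idealr_closed in_vmax.
Proof.
split; rewrite /in_vmax /in_mem /=; first by rewrite /vgt eqxx.
- by rewrite /vgt /= oner_eq0 v1 ltxx.
- move=> a x y xM yM; apply: vgtD => //; move: xM; rewrite /in_mem /= /vgt.
  case: a => a aO; rewrite /=; move: (val x) aO => {}x.
  rewrite /in_mem /= /in_vring /vge.
  have [->|a0] := eqVneq a 0; first by rewrite mul0r eqxx.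
  have [->|x0] := eqVneq x 0; first by rewrite mulr0 eqxx.
  move=> /= a1 x1; rewrite v_mul //; apply/orP; right.
  rewrite addrC; apply: lt_le_trans x1 _.
  by rewrite -[leLHS]addr0; apply: oag_leD2l.
Qed.

HB.instance Definition _ := isIdealr.Build vring in_vmax in_vmax_closed.

Definition residue_field := {ideal_quot in_vmax}.

Local Notation proj := (\pi_{ideal_quot in_vmax}).

Definition residue_inv (x : residue_field) : residue_field :=
  proj (insubd (0 : vring) (val (repr x))^-1).

Lemma vinv x : x != 0 -> v x^-1 = - v x.
Proof.
move=> x0; apply: (addrI (v x)).
by rewrite -v_mul ?invr_eq0 // divff // v1 subrr.
Qed.

Lemma residue_mulVf (x : residue_field) : x != 0 -> residue_inv x * x = 1.
Proof.
move=> x0; rewrite /residue_inv -{2}[x]reprK.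
have : repr x \notin in_vmax.
  apply: contra x0 => xM.
  by rewrite -[x]reprK -(rmorph0 proj) -Quotient.idealrBE subr0.
have := valP (repr x); set z := repr x.
rewrite in_vringE in_vmaxE negb_or => zO /andP[z0 zM].
have vz0 : v (val z) = 0.
  move: zO; rewrite (negPf z0) /= => zO; apply/eqP; apply: contraR zM => vz.
  by rewrite lt_neqAle zO eq_sym vz.
rewrite -rmorphM -(rmorph1 proj); congr (proj _).
apply: val_inj; rewrite /= val_insubd.
suff -> : (val z)^-1 \in in_vring by rewrite mulVf.
by rewrite in_vringE vinv // vz0 oppr0 lexx orbT.
Qed.

Lemma residue_inv0 : residue_inv 0 = 0.
Proof.
rewrite /residue_inv; set r : vring := repr _.
have : r \in in_vmax.
  by rewrite -[r]subr0 Quotient.idealrBE reprK rmorph0.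
rewrite in_vmaxE -[RHS](rmorph0 proj) => rM.
congr (proj _); apply: val_inj; rewrite /= val_insubd.
case: ifP => //; rewrite in_vringE invr_eq0.
case: (eqVneq (val r) 0) rM => [r0 _ _|r0 /= vr]; first by rewrite [vring_val r]r0 invr0.
rewrite vinv // => /(oag_leD2l _ _ (v (val r))); rewrite addr0 subrr.
by move=> /(lt_le_trans vr); rewrite ltxx.
Qed.

HB.instance Definition _ := GRing.ComNzRing.on residue_field.
HB.instance Definition _ :=
  GRing.ComNzRing_isField.Build residue_field residue_mulVf residue_inv0.

Definition vball (g : G) (x : K) : set K := [set y | vgt g (y - x)].

(* Filters rather than sequences: the cofinality of G is arbitrary. *)
Definition cauchy_filter (F : set_system K) : Prop :=
  forall g, exists x, F (vball g x).

Definition complete_valuation : Prop :=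
  forall F : set_system K, ProperFilter F -> cauchy_filter F ->
    exists x, forall g, F (vball g x).

End ValuationRing.

Definition is_completion (K Kc : fieldType) (G : oagType)
    (v : valuation K G) (vc : valuation Kc G) (i : {rmorphism K -> Kc}) : Prop :=
  [/\ forall x, x != 0 -> vc (i x) = v x,
      forall g (y : Kc), exists x, vball vc g y (i x) &
      complete_valuation vc].

Section Semitame.
Variables (K : fieldType) (G : oagType) (v : valuation K G).

Definition DRst (p : nat) : Prop := forall g : G, exists h : G, g = h *+ p.

(* As the completion is unique up to isomorphism, asking for one is the same
   as asking for all of them. Surjectivity of x |-> x^p on O/pO is spelled out
   on representatives. *)
Definition DRvr (p : nat) : Prop :=
  exists (Kc : fieldType) (vc : valuation Kc G) (i : {rmorphism K -> Kc}),
    is_completion v vc i /\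
    forall x : vring vc, exists y z : vring vc, x - y ^+ p = p%:R * z.

Definition semitame : Prop :=
  [pchar (residue_field v)] =i pred0 \/
  exists p, [/\ p \in [pchar (residue_field v)], DRst p & DRvr p].

End Semitame.

(* Main.v *)
From HB Require Import structures.
Require Import Defs.
From mathcomp Require Import all_boot all_order all_algebra.
From mathcomp Require Import ring_quotient.
From mathcomp Require Import boolp classical_sets functions filter.

Set Implicit Arguments.
Unset Strict Implicit.
Unset Printing Implicit Defensive.

Import Order.TTheory GRing.Theory.
Local Open Scope ring_scope.

Local Open Scope quotient_scope.
Local Open Scope classical_set_scope.

(** Let [K] have characteristic [p], and call the image of the additive map
    [x |-> x ^ p - x] its Artin-Schreier image. The proof has three steps.

    1. If [K] is definable in an NTP2 theory and is infinite enough to contain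
    some [z] with all [z ^ (p ^ k)] distinct, then the Artin-Schreier image has
    finite index. Indeed every [y] is congruent to [y ^ (p ^ k)] modulo the
    image, so for [t] equal to the sum of the [w_k ^ (p ^ (n - k))], [k <= n],
    the element [z ^ (l * p ^ n) * t] is congruent to the sum of the
    [(z ^ (p ^ k)) ^ l * w_k]. The matrix of the latter system in the unknowns
    [w_k] is a Vandermonde matrix, so one [t] satisfies arbitrarily prescribed
    congruences [z ^ (l * p ^ n) * t = r_l] for all [l <= n]
    ([artin_schreier_interpolation]). If the [r_j] represent infinitely many
    classes, the formula saying that [b * x - r] lies in the Artin-Schreier
    image therefore has an array with rows [b = z ^ (i * p ^ n)], columns
    [r = r_j], inconsistent rows and consistent paths. The coefficients depend
    on the number [n] of rows; an ultrapower over the natural numbers replaces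
    these finite arrays by an infinite one and realises its paths
    ([TP2_of_finite_arrays], by the theorem of Los). Interpreting a formula
    over [K] in the ambient structure is the role of
    [definable_artin_schreier].

    2. If some [a] stays at bounded distance from all [p]-th powers, then
    [a * u ^ p] is outside the Artin-Schreier image as soon as the value of
    [u] is very negative, since [a * u ^ p = x ^ p - x] makes [(x / u) ^ p]
    close to [a] ([artin_schreier_approx]). Applied to differences of powers of
    one [y] of very negative value, this gives infinitely many classes. Hence
    under NTP2 the [p]-th powers are dense in [K] ([NTP2_dense_powers]), and
    the value group is [p]-divisible, because elements close enough to each
    other have the same value.

    3. The completion of [K], built from Cauchy nets indexed by the value group,
    inherits density of [p]-th powers; being complete it contains the limits of
    [p]-th roots of approximations, so it is perfect
    ([completion_has_roots]). As [p = 0] there, surjectivity of [x |-> x ^ p]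
    modulo [p] is exactly this. *)

(** * Environments *)

Section Environments.
Context {M : Type}.

Lemma env_consE n (x : M) (e : 'I_n -> M) :
  env_cons x e ord0 = x /\ forall i, env_cons x e (lift ord0 i) = e i.
Proof. by rewrite /env_cons unlift_none; split=> // i; rewrite liftK. Qed.

Lemma env_cons_comp N n (f : M -> N) (x : M) (e : 'I_n -> M) :
  f \o env_cons x e = env_cons (f x) (f \o e).
Proof. by apply/funext => i; rewrite /env_cons /=; case: unliftP. Qed.

Lemma env_cat_comp N m n (f : M -> N) (a : 'I_m -> M) (b : 'I_n -> M) :
  f \o env_cat a b = env_cat (f \o a) (f \o b).
Proof. by apply/funext => i; rewrite /env_cat /=; case: splitP. Qed.

Lemma env_cat_lshift m n (a : 'I_m -> M) (b : 'I_n -> M) :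
  env_cat a b \o @lshift m n = a.
Proof.
apply/funext => i.
by rewrite /env_cat /= -[lshift n i]/(unsplit (inl i)) unsplitK.
Qed.

Lemma env_cat_rshift m n (a : 'I_m -> M) (b : 'I_n -> M) :
  env_cat a b \o @rshift m n = b.
Proof.
apply/funext => i.
by rewrite /env_cat /= -[rshift m i]/(unsplit (inr i)) unsplitK.
Qed.

Lemma env_cat_lshift_comp m n k
    (a : 'I_m -> M) (b : 'I_n -> M) (s : 'I_k -> 'I_m) :
  env_cat a b \o (@lshift m n \o s) = a \o s.
Proof. by rewrite compA env_cat_lshift. Qed.

Lemma env_cat_rshift_comp m n k
    (a : 'I_m -> M) (b : 'I_n -> M) (s : 'I_k -> 'I_n) :
  env_cat a b \o (@rshift m n \o s) = b \o s.
Proof. by rewrite compA env_cat_rshift. Qed.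

Definition env_catE :=
  (@env_cat_lshift_comp, @env_cat_rshift_comp,
   @env_cat_lshift, @env_cat_rshift).

Lemma env_cat_shift m n (c : 'I_(m + n) -> M) :
  env_cat (c \o @lshift m n) (c \o @rshift m n) = c.
Proof.
apply/funext => i; rewrite /env_cat.
by case: splitP => j e; congr c; apply: val_inj.
Qed.

Lemma env_cat_inj m n (a a' : 'I_m -> M) (b b' : 'I_n -> M) :
  env_cat a b = env_cat a' b' -> a = a' /\ b = b'.
Proof.
move=> e; split.
- by rewrite -[LHS](env_cat_lshift a b) e env_cat_lshift.
- by rewrite -[LHS](env_cat_rshift a b) e env_cat_rshift.
Qed.

Lemma env0_unique (a b : 'I_0 -> M) : a = b.
Proof. by apply/funext => -[]. Qed.

Lemma env_cat0 n (a : 'I_0 -> M) (b : 'I_n -> M) : env_cat a b = b.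
Proof.
rewrite -[RHS](env_cat_rshift a b); apply/funext => i /=.
by congr env_cat; apply: val_inj.
Qed.

Lemma env_cat_cons k n (x : M) (a : 'I_k -> M) (b : 'I_n -> M) :
  env_cat (env_cons x a) b = env_cons x (env_cat a b) :> ('I_(k.+1 + n) -> M).
Proof.
rewrite -[RHS](@env_cat_shift k.+1 n).
have [E0 ES] := env_consE x (env_cat a b).
congr env_cat; apply/funext => i /=.
- case: (unliftP ord0 i) => [j|] ->.
  + have [_ ->] := env_consE x a.
    rewrite (_ : lshift n (lift ord0 j) = lift ord0 (lshift n j)) ?ES.
      by rewrite -[a in LHS](env_cat_lshift a b).
    by apply: val_inj.
  + have [-> _] := env_consE x a.
    rewrite (_ : lshift n ord0 = ord0 :> 'I_(k + n).+1) ?E0 //.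
    by apply: val_inj.
- rewrite (_ : rshift k.+1 i = lift ord0 (rshift k i)) ?ES.
    by rewrite -[b in LHS](env_cat_rshift a b).
  by apply: val_inj.
Qed.

Lemma env_cons_surj n (e : 'I_n.+1 -> M) :
  env_cons (e ord0) (e \o lift ord0) = e.
Proof. by apply/funext => i; rewrite /env_cons; case: unliftP => [j|] ->. Qed.

End Environments.

(** * Formulas and definable sets *)

Section Formulas.
Variable L : language.

Fixpoint term_rename n n' (s : 'I_n -> 'I_n') (t : fo_term L n) :
    fo_term L n' :=
  match t with
  | TVar v => TVar L (s v)
  | TApp f ts => TApp (fun i => term_rename s (ts i))
  end.

Definition lift_renaming n n' (s : 'I_n -> 'I_n') : 'I_n.+1 -> 'I_n'.+1 :=
  env_cons ord0 (lift ord0 \o s).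

Fixpoint rename n (phi : fo_formula L n) :
    forall n', ('I_n -> 'I_n') -> fo_formula L n' :=
  match phi in fo_formula _ n
    return forall n', ('I_n -> 'I_n') -> fo_formula L n' with
  | FFalse _ => fun n' _ => FFalse L n'
  | FEq _ t u => fun _ s => FEq (term_rename s t) (term_rename s u)
  | FRel _ r ts => fun _ s => FRel (fun i => term_rename s (ts i))
  | FImp _ phi psi => fun _ s => FImp (rename phi s) (rename psi s)
  | FAll _ phi => fun _ s => FAll (rename phi (lift_renaming s))
  end.

Lemma teval_rename (M : fo_structure L) n n' (s : 'I_n -> 'I_n') e t :
  teval (M := M) e (term_rename s t) = teval (e \o s) t.
Proof.
by elim: t => //= f ts IH; congr finterp; apply/funext => i; apply: IH.
Qed.

Lemma sat_rename (M : fo_structure L) n (phi : fo_formula L n) :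
  forall n' (s : 'I_n -> 'I_n') (e : 'I_n' -> M),
    sat (rename phi s) e <-> sat phi (e \o s).
Proof.
elim: phi => {n} [n|n t u|n r ts|n phi IH psi IH'|n phi IH] n' s e //=.
- by rewrite !teval_rename.
- have -> // : (fun i => teval e (term_rename s (ts i))) =
               (fun i => teval (e \o s) (ts i)).
  by apply/funext => i; apply: teval_rename.
- by rewrite IH IH'.
- have E x : env_cons x e \o lift_renaming s = env_cons x (e \o s).
    rewrite env_cons_comp; congr (env_cons _ _).
      by case: (env_consE x e).
    by apply/funext => i /=; case: (env_consE x e).
  by split=> H x; have := H x; rewrite IH E.
Qed.

Definition fnot n (phi : fo_formula L n) := FImp phi (FFalse L n).
Definition fand n (phi psi : fo_formula L n) := fnot (FImp phi (fnot psi)).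

Fixpoint fall k n : fo_formula L (k + n) -> fo_formula L n :=
  match k return fo_formula L (k + n) -> fo_formula L n with
  | 0 => fun phi => phi
  | k'.+1 => fun phi => @fall k' n (FAll (phi : fo_formula L (k' + n).+1))
  end.

Definition fex k n (phi : fo_formula L (k + n)) := fnot (fall (fnot phi)).

Variable M : fo_structure L.

Lemma sat_and n (phi psi : fo_formula L n) (e : 'I_n -> M) :
  sat (fand phi psi) e <-> sat phi e /\ sat psi e.
Proof.
rewrite /fand; split=> /= [H|[H H'] K]; last exact: (K H H').
by split; apply: contrapT => K; apply: H => p q; apply: K.
Qed.

Lemma sat_all k n (phi : fo_formula L (k + n)) (e : 'I_n -> M) :
  sat (fall phi) e <-> forall x : 'I_k -> M, sat phi (env_cat x e).
Proof.
elim: k phi => [|k IH] phi /=.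
  split=> [H x|/(_ (@env0 M))]; last by rewrite env_cat0.
  by rewrite env_cat0.
rewrite IH; split=> [H x|H x y].
  by rewrite -(env_cons_surj x) env_cat_cons; apply: H.
by rewrite -env_cat_cons; apply: (H (env_cons y x)).
Qed.

Lemma sat_ex k n (phi : fo_formula L (k + n)) (e : 'I_n -> M) :
  sat (fex phi) e <-> exists x : 'I_k -> M, sat phi (env_cat x e).
Proof.
rewrite /fex /=; split=> [H|[x H] /sat_all/(_ x)]; last exact.
apply: contrapT => K; apply: H; apply/sat_all => x /= S.
by apply: K; exists x.
Qed.

Lemma definable_rename n n' (s : 'I_n -> 'I_n') (R : set ('I_n -> M)) :
  definable_set R -> definable_set [set c : 'I_n' -> M | R (c \o s)].
Proof.
move=> [m [phi [b H]]].
exists m, (rename phi (env_cat (@lshift n' m \o s) (@rshift n' m))), b => c /=.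
by rewrite sat_rename env_cat_comp compA env_cat_lshift env_cat_rshift.
Qed.

Lemma definable_and n (R S : set ('I_n -> M)) :
  definable_set R -> definable_set S ->
  definable_set [set c : 'I_n -> M | R c /\ S c].
Proof.
move=> [m [phi [b H]]] [m' [phi' [b' H']]].
exists (m + m')%N, (fand
  (rename phi (env_cat (@lshift n (m + m')) (@rshift n _ \o @lshift m m')))
  (rename phi' (env_cat (@lshift n (m + m')) (@rshift n _ \o @rshift m m')))),
  (env_cat b b') => c.
rewrite sat_and !sat_rename !env_cat_comp !compA.
by rewrite !env_cat_lshift !env_cat_rshift env_cat_lshift /mkset H H'.
Qed.

Lemma definable_ex k n (R : set ('I_(k + n) -> M)) :
  definable_set R ->
  definable_set [set c : 'I_n -> M | exists x, R (env_cat x c)].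
Proof.
move=> [m [phi [b H]]].
pose s : 'I_(k + n + m) -> 'I_(k + (n + m)) :=
  env_cat (env_cat (@lshift k _) (@rshift k _ \o @lshift n m))
          (@rshift k _ \o @rshift n m).
exists m, (fex (rename phi s)), b => c.
rewrite sat_ex; rewrite /mkset; split=> -[x Hx]; exists x; move: Hx;
  rewrite sat_rename !env_cat_comp !compA env_cat_lshift !env_cat_rshift;
  by rewrite env_cat_lshift H.
Qed.

End Formulas.

(** * Ultrapowers and the tree property *)

Section Ultrapower.
Variables (L : language) (M : fo_structure L) (U : set_system nat).
Hypothesis UU : UltraFilter U.

Let PU : ProperFilter U := @ultra_proper _ _ UU.
Let FU : Filter U := @filter_filter _ _ PU.

Definition eq_mod_ultra (s t : {classic (nat -> M)}) : bool :=
  `[< U [set k | s k = t k] >].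

Lemma eq_mod_ultra_equiv : equiv_class_of eq_mod_ultra.
Proof.
split=> [s|s t|t s r].
- by apply/asboolP; apply: filterS filterT.
- by apply/asboolP/asboolP; apply: filterS => k /= ->.
- move=> /asboolP st /asboolP tr; apply/asboolP.
  by apply: filterS2 st tr => k /= -> ->.
Qed.

Canonical eq_mod_ultra_equivRel := EquivRelPack eq_mod_ultra_equiv.

Definition ultrapower_carrier : Type := {eq_quot eq_mod_ultra_equivRel}.

Definition ultraclass (s : nat -> M) : ultrapower_carrier :=
  \pi_{eq_quot eq_mod_ultra_equivRel} s.

Definition ultrarepr (x : ultrapower_carrier) : nat -> M :=
  repr (x : {eq_quot eq_mod_ultra_equivRel}).

Lemma ultrareprK x : ultraclass (ultrarepr x) = x.
Proof. exact: reprK. Qed.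

Lemma ultraclassP s t : ultraclass s = ultraclass t <-> U [set k | s k = t k].
Proof.
split=> [/eqmodP/asboolP //|H]; exact/eqmodP/asboolP.
Qed.

Lemma ultraclassK s : U [set k | ultrarepr (ultraclass s) k = s k].
Proof. by apply/ultraclassP; rewrite ultrareprK. Qed.

Definition ultrapower : fo_structure L := @FoStructure L ultrapower_carrier
  (let: inhabits x := carrier_nonempty M in inhabits (ultraclass (fun=> x)))
  (fun f args => ultraclass (fun k => finterp (fun i => ultrarepr (args i) k)))
  (fun r args => U [set k | rinterp (fun i => ultrarepr (args i) k)]).

Lemma ultraclass_args n (e : 'I_n -> nat -> M) :
  U [set k | (fun i => ultrarepr (ultraclass (e i)) k) = e^~ k].
Proof.
have : U [set k | forall i, ultrarepr (ultraclass (e i)) k = e i k].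
  by apply: filter_forall => i; apply: ultraclassK.
by apply: filterS => k H; apply/funext.
Qed.

Lemma teval_ultrapower n (e : 'I_n -> nat -> M) (t : fo_term L n) :
  teval (M := ultrapower) (ultraclass \o e) t =
  ultraclass (fun k => teval (e^~ k) t).
Proof.
elim: t => //= f ts IH; apply/ultraclassP.
apply: filterS (ultraclass_args (fun i k => teval (e^~ k) (ts i))) => k /= <-.
by congr finterp; apply/funext => i; rewrite IH.
Qed.

(** Los's theorem. In the quantifier case, a universal statement failing on a
    large set of coordinates has a counterexample chosen coordinatewise. *)
Lemma Los n (phi : fo_formula L n) (e : 'I_n -> nat -> M) :
  sat (M := ultrapower) phi (ultraclass \o e) <-> U [set k | sat phi (e^~ k)].
Proof.
elim: phi e => {n} [n|n t u|n r ts|n phi IH psi IH'|n phi IH] e /=.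
- by split=> // H; have [k] := filter_ex H.
- rewrite !teval_ultrapower; exact: ultraclassP.
- have A := ultraclass_args (fun i k => teval (e^~ k) (ts i)).
  have E k :
      (fun i => ultrarepr
         (teval (M := ultrapower) (ultraclass \o e) (ts i)) k) =
      fun i => ultrarepr (ultraclass (fun k => teval (e^~ k) (ts i))) k.
    by apply/funext => i; rewrite teval_ultrapower.
  by split; apply: filterS2 A => k /=; rewrite E => ->.
- rewrite IH IH'; split=> [H|H H'].
    have [/H|] := in_ultra_setVsetC [set k | sat phi (e^~ k)] UU.
      by apply: filterS => k /= Q _.
    by apply: filterS => k /= N P; case: N.
  by apply: filterS2 H H' => k /= H /H.
- have C s : env_cons (ultraclass s) (ultraclass \o e) =
      ultraclass \o env_cons s e by rewrite env_cons_comp.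
  have D s k : (env_cons s e)^~ k = env_cons (s k) (e^~ k).
    exact: (env_cons_comp (fun f => f k)).
  split=> [H|H x].
    have [//|N] := in_ultra_setVsetC
      [set k | forall x, sat phi (env_cons x (e^~ k))] UU.
    have [x0] := carrier_nonempty M.
    have /choice [s Hs] : forall k, exists x : M,
        ~ (forall y, sat phi (env_cons y (e^~ k))) ->
        ~ sat phi (env_cons x (e^~ k)).
      move=> k; have [Q|/existsNP [x Hx]] :=
        pselect (forall y, sat phi (env_cons y (e^~ k))).
        by exists x0.
      by exists x.
    have := H (ultraclass s); rewrite C IH => K.
    have [k [/= P]] := filter_ex (filterI K N).
    by move/Hs; rewrite -D.
  rewrite -(ultrareprK x) C IH; apply: filterS H => k /= H.
  by rewrite D.
Qed.

Lemma ultrapower_models (T : theory L) : models M T -> models ultrapower T.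
Proof.
move=> MT s Ts.
rewrite (env0_unique (@env0 ultrapower) (ultraclass \o @env0 (nat -> M))).
apply/Los; apply: filterS filterT => k _.
by rewrite /= [X in sat s X](env0_unique _ (@env0 M)); apply: MT.
Qed.

End Ultrapower.

(** The array may depend on the number of rows to be handled: the class of
    [N |-> a N i j] in an ultrapower works for all rows at once, since row [i]
    is correct for all [N >= i]. A path is realised in that same ultrapower by
    the class of realisations of its finite initial segments. Inconsistency of
    rows in elementary extensions goes through the existential formula [psi],
    whose truth descends to the ultrapower and then to the original model. *)
Lemma TP2_of_finite_arrays (L : language) (T : theory L) (M : fo_structure L)
    m n (phi : fo_formula L (m + n)) :
  models M T ->
  (forall N, exists a : nat -> nat -> 'I_n -> M,
    (forall i j j' x, (i <= N)%N ->
      sat phi (env_cat x (a i j)) -> sat phi (env_cat x (a i j')) -> j = j') /\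
    (forall f : nat -> nat, exists x, forall i, (i <= N)%N ->
      sat phi (env_cat x (a i (f i))))) ->
  TP2 T phi.
Proof.
move=> MT /choice [a Ha].
have [U [UU leU]] := ultraFilterLemma (@eventually_filter).
have PU : ProperFilter U := @ultra_proper _ _ UU.
pose P := ultrapower M UU.
pose A i j (v : 'I_n) : P := ultraclass UU (fun N => a N i j v).
have large i : U [set N | (i <= N)%N] by apply: leU; exists i.
exists P, A, 2; split=> //; first exact: ultrapower_models.
- move=> i J J_inj [N [e [c [e_elem Hc]]]].
  pose s j : 'I_(m + n) -> 'I_(m + (n + n)) :=
    env_cat (@lshift m _)
      (@rshift m _ \o (if j then @lshift n n else @rshift n n)).
  pose psi := fex (fand (rename phi (s true)) (rename phi (s false))).
  have psiE (Q : fo_structure L) (b b' : 'I_n -> Q) : sat psi (env_cat b b') <->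
      exists x, sat phi (env_cat x b) /\ sat phi (env_cat x b').
    rewrite sat_ex; split=> -[x Hx]; exists x; move: Hx;
    rewrite sat_and !sat_rename !env_cat_comp !compA env_cat_lshift;
    by rewrite env_cat_rshift env_cat_lshift env_cat_rshift.
  pose j0 := J ord0; pose j1 := J ord_max.
  suff : j0 = j1 by move/J_inj.
  have : sat (M := N) psi (e \o env_cat (A i j0) (A i j1)).
    rewrite env_cat_comp psiE; exists c.
    by split; apply: Hc; [exists ord0 | exists ord_max].
  rewrite -e_elem.
  have -> : env_cat (A i j0) (A i j1) = ultraclass UU \o
      (fun v N => env_cat (a N i j0) (a N i j1) v).
    apply/funext => v; rewrite /env_cat /= /A.
    by case: splitP.
  rewrite Los => /(filterI (large i)) /filter_ex [K [/= iK]].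
  move/(psiE M (a K i j0)) => [x [H0 H1]].
  by have [+ _] := Ha K; apply; eassumption.
- move=> f; exists P, id.
  have /choice [x Hx] : forall N, exists x, forall i, (i <= N)%N ->
      sat phi (env_cat x (a N i (f i))) by move=> N; case: (Ha N).
  exists (fun v => ultraclass UU (x^~ v)); split=> // _ [i _ <-].
  have -> : env_cat (fun v => ultraclass UU (x^~ v)) (id \o A i (f i)) =
     ultraclass UU \o (fun v N => env_cat (x N) (a N i (f i)) v).
    by apply/funext => v; rewrite /env_cat /= /A; case: splitP.
  by rewrite Los; apply: filterS (large i) => N /Hx.
Qed.

(** * Definability over a definable field *)

Section DefinableField.
Variables (L : language) (M : fo_structure L) (K : fieldType) (n : nat).
Variable h : K -> 'I_n -> M.
Hypothesis h_inj : injective h.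

Definition graph2 (f : K -> K -> K) : set ('I_(n + n + n) -> M) :=
  [set c | exists x y, c = env_cat (env_cat (h x) (h y)) (h (f x y))].

Lemma definable_op f N (s1 s2 s3 : 'I_n -> 'I_N) :
  definable_set (graph2 f) ->
  definable_set [set c : 'I_N -> M | exists x y,
    [/\ c \o s1 = h x, c \o s2 = h y & c \o s3 = h (f x y)]].
Proof.
move=> /(definable_rename (env_cat (env_cat s1 s2) s3)); congr definable_set.
apply/seteqP; split=> c /= -[x [y]]; rewrite !env_cat_comp.
  by case/env_cat_inj => /env_cat_inj [? ?] ?; exists x, y.
by case=> -> -> ->; exists x, y.
Qed.

Hypothesis definable_mul : definable_set (graph2 *%R).

(** Exponents start at 2 because the square is already an instance of the
    multiplication graph, whereas the identity would need equality of tuples. *)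
Lemma definable_exp k N (s1 s2 : 'I_n -> 'I_N) :
  definable_set [set c : 'I_N -> M | exists x,
    c \o s1 = h x /\ c \o s2 = h (x ^+ k.+2)].
Proof.
elim: k N s1 s2 => [|k IH] N s1 s2.
  have := definable_op s1 s1 s2 definable_mul; congr definable_set.
  apply/seteqP; split=> c /= [x].
    by move=> [y [-> /h_inj <- ->]]; exists x; rewrite expr2.
  by rewrite expr2 => -[cx cs]; exists x, x.
have := definable_ex (definable_and
  (IH (n + N)%N (@rshift n N \o s1) (@lshift n N))
  (definable_op (@rshift n N \o s1) (@lshift n N) (@rshift n N \o s2)
     definable_mul)).
congr definable_set; apply/seteqP; split=> c /=.
  move=> [w [[x []]]]; rewrite !env_catE => cx ->.
  move=> [y [z [cy /h_inj <- ->]]]; exists x; split=> //.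
  by rewrite exprS; move: cy; rewrite cx => /h_inj <-.
move=> [x [cx cs]]; exists (h (x ^+ k.+2)).
rewrite !env_catE; split; first by exists x.
by exists x, (x ^+ k.+2); rewrite -exprS.
Qed.

Hypothesis definable_add : definable_set (graph2 +%R).

(** The equation is [b * t - r = u ^ p - u] without subtraction. The
    existential block consists of [u], [q = u ^ p], [m = b * t] and the common
    value [s] of both sides. *)
Lemma definable_artin_schreier p : (1 < p)%N ->
  definable_set [set c : 'I_(n + (n + n)) -> M | exists t b r u,
    c = env_cat (h t) (env_cat (h b) (h r)) /\ b * t + u = u ^+ p + r].
Proof.
case: p => [|[|p]] // _.
pose W := (n + n + (n + n))%N; pose N := (W + (n + (n + n)))%N.
pose wit i := @lshift W (n + (n + n)) \o i : 'I_n -> 'I_N.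
pose par i := @rshift W (n + (n + n)) \o i : 'I_n -> 'I_N.
pose u := wit (@lshift (n + n) (n + n) \o @lshift n n).
pose q := wit (@lshift (n + n) (n + n) \o @rshift n n).
pose m := wit (@rshift (n + n) (n + n) \o @lshift n n).
pose s := wit (@rshift (n + n) (n + n) \o @rshift n n).
pose t := par (@lshift n (n + n)).
pose b := par (@rshift n (n + n) \o @lshift n n).
pose r := par (@rshift n (n + n) \o @rshift n n).
have := definable_ex (definable_and
  (definable_and (definable_exp p u q) (definable_op q r s definable_add))
  (definable_and (definable_op b t m definable_mul)
     (definable_op m u s definable_add))).
have Ew w (c : 'I_(n + (n + n)) -> M) i : env_cat w c \o wit i = w \o i.
  exact: env_cat_lshift_comp.
have Ep w (c : 'I_(n + (n + n)) -> M) i : env_cat w c \o par i = c \o i.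
  exact: env_cat_rshift_comp.
congr definable_set; apply/seteqP; split=> c /=.
  rewrite /u /q /m /s /t /b /r => -[w]; rewrite !(Ew, Ep).
  move=> [[[u' [-> ->]] [? [r' [/h_inj <- cr ->]]]]].
  move=> [[b' [t' [cb ct ->]]]] [? [? [/h_inj <- /h_inj <- /h_inj e]]].
  exists t', b', r', u'; split=> //.
  rewrite -[LHS]env_cat_shift -[c \o @rshift _ _]env_cat_shift ct.
  by rewrite -cb -cr.
move=> [t' [b' [r' [u' [-> e]]]]].
exists (env_cat (env_cat (h u') (h (u' ^+ p.+2)))
  (env_cat (h (b' * t')) (h (b' * t' + u')))).
rewrite /u /q /m /s /t /b /r !(Ew, Ep) !env_catE; split; split.
- by exists u'.
- by exists (u' ^+ p.+2), r'; rewrite e.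
- by exists b', t'.
- by exists (b' * t'), u'.
Qed.

End DefinableField.

(** * The Artin-Schreier image *)

Section ArtinSchreier.
Variables (K : fieldType) (p : nat).
Hypothesis charKp : p \in [pchar K].

Definition artin_schreier : set K := [set x | exists u, x = u ^+ p - u].

Lemma char_exprB (x y : K) : (x - y) ^+ p = x ^+ p - y ^+ p.
Proof. by have := pFrobenius_autB_comm charKp (mulrC x y). Qed.

Lemma char_exprD (x y : K) : (x + y) ^+ p = x ^+ p + y ^+ p.
Proof. by have := pFrobenius_autD_comm charKp (mulrC x y). Qed.

Lemma char_expr0 : (0 : K) ^+ p = 0.
Proof. by rewrite expr0n gtn_eqF // prime_gt0 // (pcharf_prime charKp). Qed.

Lemma artin_schreierD x y :
  artin_schreier x -> artin_schreier y -> artin_schreier (x + y).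
Proof.
by move=> [u ->] [w ->]; exists (u + w); rewrite char_exprD opprD addrACA.
Qed.

Lemma artin_schreierB x y :
  artin_schreier x -> artin_schreier y -> artin_schreier (x - y).
Proof.
move=> [u ->] [w ->]; exists (u - w).
by rewrite char_exprB !opprD !opprK addrACA.
Qed.

Lemma artin_schreier_sum (I : Type) (s : seq I) (F : I -> K) :
  (forall i, artin_schreier (F i)) -> artin_schreier (\sum_(i <- s) F i).
Proof.
move=> HF; elim: s => [|i s IH].
  by rewrite big_nil; exists 0; rewrite char_expr0 subrr.
by rewrite big_cons; apply: artin_schreierD.
Qed.

(** The difference telescopes through the [y ^ (p ^ j)], [j <= k]. *)
Lemma artin_schreier_exp y k : artin_schreier (y ^+ (p ^ k) - y).
Proof.
elim: k => [|k IH]; first by exists 0; rewrite char_expr0 expr1 !subrr.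
rewrite -(subrK (y ^+ (p ^ k)) (y ^+ (p ^ k.+1))) -addrA.
by apply: artin_schreierD IH; exists (y ^+ (p ^ k)); rewrite -exprM -expnSr.
Qed.

Lemma vandermonde_solve (n : nat) (a : nat -> K) (r : nat -> K) :
  injective a ->
  exists w : 'I_n -> K,
    forall l, (l < n)%N -> \sum_(k < n) a k ^+ l * w k = r l.
Proof.
move=> a_inj; pose x : 'rV[K]_n := \row_k a k; pose V := Vandermonde n x.
have V_unit : V \in unitmx.
  rewrite unitmxE det_Vandermonde unitfE; apply/prodf_neq0 => i _.
  apply/prodf_neq0 => j ij; rewrite !mxE subr_eq0.
  by apply: contraTneq ij => /a_inj/val_inj ->; rewrite ltnn.
pose w := invmx V *m \col_(l < n) r l.
exists (fun k => w k 0) => l ln.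
have /matrixP/(_ (Ordinal ln) 0) : V *m w = \col_(l < n) r l by rewrite mulKVmx.
by rewrite !mxE => <-; apply: eq_bigr => k _; rewrite !mxE.
Qed.

(** Each summand of [z ^ (l * p ^ n) * t] is the [p ^ (n - k)]-th power of
    [(z ^ (p ^ k)) ^ l * w k], hence congruent to it: modulo the Artin-Schreier
    image the additive polynomial [t] in the [w k] becomes linear, with a
    Vandermonde matrix. Choosing the coefficients among [p ^ n]-th powers is
    what makes this possible over an imperfect [K]. *)
Lemma artin_schreier_interpolation (z : K) (n : nat) (r : nat -> K) :
  injective (fun k => z ^+ (p ^ k)) ->
  exists t, forall l, (l <= n)%N ->
    artin_schreier (z ^+ (l * p ^ n) * t - r l).
Proof.
move=> /(vandermonde_solve n.+1 r) [w Hw].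
exists (\sum_k w k ^+ (p ^ (n - k))) => l ln.
rewrite -(Hw l ln) mulr_sumr -sumrB; apply: artin_schreier_sum => k.
have -> : z ^+ (l * p ^ n) = (z ^+ (p ^ k) ^+ l) ^+ (p ^ (n - k)).
  by rewrite -!exprM mulnCA -expnD subnKC // -ltnS.
by rewrite -exprMn; apply: artin_schreier_exp.
Qed.

End ArtinSchreier.

(** Under NTP2 the Artin-Schreier image has finite index: infinitely many
    classes would give the columns of an array with the tree property. *)
Lemma NTP2_artin_schreier_classes (K : fieldType) p (z : K) (r : nat -> K) :
  definable_in_NTP2 K -> p \in [pchar K] ->
  injective (fun k => z ^+ (p ^ k)) ->
  (forall i j, artin_schreier p (r i - r j) -> i = j) -> False.
Proof.
move=> [L [T [_ T_NTP2 [M [MT [n [h [h_inj _ hD hM]]]]]]]] charKp z_inj r_inj.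
have p_gt1 : (1 < p)%N by apply/prime_gt1/pcharf_prime/charKp.
have [m [phi [b0 Hphi]]] := definable_artin_schreier h_inj hM hD p_gt1.
pose s : 'I_(n + (n + n) + m) -> 'I_(n + (n + n + m)) :=
  env_cat (env_cat (@lshift n _) (@rshift n _ \o @lshift _ m))
    (@rshift n _ \o @rshift _ m).
apply: (T_NTP2 _ _ (rename phi s)).
apply: (TP2_of_finite_arrays MT) => N.
pose a i j := env_cat (env_cat (h (z ^+ (i * p ^ N))) (h (r j))) b0.
have satE i j x : sat (rename phi s) (env_cat x (a i j)) <->
    exists t, x = h t /\ artin_schreier p (z ^+ (i * p ^ N) * t - r j).
  rewrite sat_rename !env_cat_comp !compA env_cat_lshift !env_cat_rshift.
  rewrite env_cat_lshift -Hphi; split.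
    move=> [t [b [r' [u [/env_cat_inj [->]]]]]].
    move=> /env_cat_inj [/h_inj -> /h_inj ->] e.
    exists t; split=> //; exists u.
    by apply/eqP; rewrite subr_eq addrAC -e addrK.
  move=> [t [-> [u /eqP]]]; rewrite subr_eq addrAC => /eqP e.
  by exists t, (z ^+ (i * p ^ N)), (r j), u; rewrite e subrK.
exists a; split=> [i j j' x _|f].
  move=> /satE [t [-> ASj]] /satE [_ [/h_inj <- ASj']]; apply: r_inj.
  have := artin_schreierB charKp ASj' ASj; congr artin_schreier.
  by rewrite opprB addrC addrA subrK.
have [t Ht] := artin_schreier_interpolation charKp N (r \o f) z_inj.
by exists (h t) => i /Ht; rewrite satE => AS; exists t.
Qed.

(** * Ordered abelian groups and valuations *)

Section OrderedGroup.
Context {G : oagType}.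
Implicit Types g h : G.

Lemma oag_leD2lE z g h : (z + g <= z + h) = (g <= h).
Proof.
apply/idP/idP; last exact: oag_leD2l.
by move=> /(oag_leD2l _ _ (- z)); rewrite !addKr.
Qed.

Lemma oag_ltD2lE z g h : (z + g < z + h) = (g < h).
Proof. by rewrite !lt_neqAle oag_leD2lE (inj_eq (addrI z)). Qed.

Lemma oag_leD g h g' h' : g <= h -> g' <= h' -> g + g' <= h + h'.
Proof.
move=> gh gh'; apply: le_trans (_ : g + h' <= _); first by rewrite oag_leD2lE.
by rewrite ![_ + h']addrC oag_leD2lE.
Qed.

Lemma oag_le_ltD g h g' h' : g <= h -> g' < h' -> g + g' < h + h'.
Proof.
move=> gh gh'; apply: lt_le_trans (_ : g + h' <= _).
  by rewrite oag_ltD2lE.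
by rewrite ![_ + h']addrC oag_leD2lE.
Qed.

Lemma oag_ltNge g h : (g < h) = ~~ (h <= g).
Proof.
apply/idP/idP => [gh|]; first by apply/negP => /(lt_le_trans gh); rewrite ltxx.
have := oag_le_total g h; case: (h <= g) / boolP => //= hg /orP[gh|//] _.
by rewrite lt_neqAle gh andbT; apply: contraNneq hg => ->.
Qed.

Lemma oag_leNgt g h : (g <= h) = ~~ (h < g).
Proof. by rewrite oag_ltNge negbK. Qed.

Lemma oag_leMn k g h : g <= h -> g *+ k <= h *+ k.
Proof.
by move=> gh; elim: k => // k IH; rewrite !mulrS; apply: oag_leD.
Qed.

Lemma oag_ltMn k g h : g < h -> g *+ k.+1 < h *+ k.+1.
Proof.
move=> gh; rewrite !mulrS addrC [h + _]addrC.
by apply: oag_le_ltD => //; apply/oag_leMn/ltW.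
Qed.

Lemma oag_ltMn2r k g h : (0 < k)%N -> (g *+ k < h *+ k) = (g < h).
Proof.
case: k => // k _; apply/idP/idP; last exact: oag_ltMn.
by apply: contraLR; rewrite -!oag_leNgt; apply: oag_leMn.
Qed.

Lemma oag_leMn2r k g h : (0 < k)%N -> (g *+ k <= h *+ k) = (g <= h).
Proof. by move=> k0; rewrite !oag_leNgt oag_ltMn2r. Qed.

Lemma oag_neg_ltMn k l g : g < 0 -> (k < l)%N -> g *+ l < g *+ k.
Proof.
move=> g0 /subnKC <-; rewrite addSn -addnS mulrnDr -[ltRHS]addr0 oag_ltD2lE.
by have := oag_ltMn (l - k.+1) g0; rewrite mul0rn.
Qed.

Lemma oag_neg_leMn k l g : g <= 0 -> (k <= l)%N -> g *+ l <= g *+ k.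
Proof.
move=> g0 /subnKC <-; rewrite mulrnDr -[leRHS]addr0 oag_leD2lE.
by have := oag_leMn (l - k) g0; rewrite mul0rn.
Qed.

Lemma oag_ge_exists g h : exists k, g <= k /\ h <= k.
Proof.
by have /orP[gh|hg] := oag_le_total g h; [exists h | exists g].
Qed.

(** The filter along which nets indexed by [G] converge. *)
Definition oag_infty : set_system G :=
  [set A | exists g, forall k, g <= k -> A k].

Lemma oag_infty_ge g : oag_infty [set k | g <= k].
Proof. by exists g. Qed.

Lemma oag_infty_proper : ProperFilter oag_infty.
Proof.
split; first by move=> [g /(_ g (lexx g))].
split; first by exists 0.
- move=> A B [g Ag] [h Bh]; have [k [gk hk]] := oag_ge_exists g h.
  by exists k => l kl; split; [apply/Ag/(le_trans gk)|apply/Bh/(le_trans hk)].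
- by move=> A B AB [g Ag]; exists g => k /Ag/AB.
Qed.

End OrderedGroup.

#[export] Existing Instance oag_infty_proper.

Section Valuations.
Variables (K : fieldType) (G : oagType) (v : valuation K G).
Implicit Types (g h : G) (x y : K).

Lemma vgt0 g : vgt v g 0. Proof. by rewrite /vgt eqxx. Qed.

Lemma vgtN g x : vgt v g (- x) = vgt v g x.
Proof. by rewrite /vgt oppr_eq0 vN. Qed.

Lemma vgtBC g x y : vgt v g (x - y) = vgt v g (y - x).
Proof. by rewrite -vgtN opprB. Qed.

Lemma vgtB g x y : vgt v g x -> vgt v g y -> vgt v g (x - y).
Proof. by move=> gx gy; apply: vgtD; rewrite ?vgtN. Qed.

Lemma vgt_trans g y x z : vgt v g (x - y) -> vgt v g (y - z) -> vgt v g (x - z).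
Proof. by move=> /vgtD H /H; rewrite addrA subrK. Qed.

Lemma vgt_le g h x : g <= h -> vgt v h x -> vgt v g x.
Proof. by rewrite /vgt => gh; case: eqP => //= _; apply: le_lt_trans. Qed.

Lemma vgt_vge g x : vgt v g x -> vge v g x.
Proof. by rewrite /vgt /vge => /orP[->//|/ltW ->]; rewrite orbT. Qed.

Lemma vge_vgtM g h x y : vge v g x -> vgt v h y -> vgt v (g + h) (x * y).
Proof.
rewrite /vgt /vge; have [->|x0] := eqVneq x 0; first by rewrite mul0r eqxx.
have [->|y0] := eqVneq y 0; first by rewrite mulr0 eqxx.
by rewrite v_mul // mulf_eq0 (negPf x0) (negPf y0) /=; apply: oag_le_ltD.
Qed.

Lemma v_exp x k : x != 0 -> v (x ^+ k) = v x *+ k.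
Proof.
move=> x0; elim: k => [|k IH]; first by rewrite expr0 v1.
by rewrite exprS v_mul ?expf_neq0 // IH mulrS.
Qed.

Lemma vgt_exp g x k : (0 < k)%N -> vgt v (g *+ k) (x ^+ k) = vgt v g x.
Proof.
move=> k0; rewrite /vgt expf_eq0 k0.
by have [//|x0] := eqVneq x 0; rewrite /= v_exp // oag_ltMn2r.
Qed.

Lemma vge_exp g x k : (0 < k)%N -> vge v (g *+ k) (x ^+ k) = vge v g x.
Proof.
move=> k0; rewrite /vge expf_eq0 k0.
by have [//|x0] := eqVneq x 0; rewrite /= v_exp // oag_leMn2r.
Qed.

Lemma vgtNP g x : ~~ vgt v g x -> x != 0 /\ v x <= g.
Proof. by rewrite /vgt negb_or -oag_leNgt => /andP[]. Qed.

Lemma v_close x y : x != 0 -> vgt v (v x) (y - x) -> y != 0 /\ v y = v x.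
Proof.
move=> x0 yx.
have y0 : y != 0.
  by apply: contraTneq yx => ->; rewrite vgtBC subr0 /vgt (negPf x0) ltxx.
split=> //; apply/eqP; rewrite eq_le !oag_leNgt.
apply/andP; split; apply/negP => lt.
- have : vgt v (v x) (y - (y - x)) by apply: vgtB yx; rewrite /vgt lt orbT.
  by rewrite opprB addrC subrK /vgt (negPf x0) ltxx.
- have : vge v (v x) (x + (y - x)).
    by apply: vgeD (vgt_vge yx); rewrite /vge lexx orbT.
  by rewrite addrC subrK /vge (negPf y0) /= oag_leNgt lt.
Qed.

Lemma vgt_eq0 x : (forall g, 0 <= g -> vgt v g x) -> x = 0.
Proof.
move=> H; apply/eqP; apply: contraT => x0.
have [g [g0 gx]] := oag_ge_exists 0 (v x).
by have := vgt_le gx (H g g0); rewrite /vgt (negPf x0) ltxx.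
Qed.

Section Characteristic.
Variable p : nat.
Hypothesis charKp : p \in [pchar K].

Let p_gt1 : (1 < p)%N. Proof. exact/prime_gt1/pcharf_prime/charKp. Qed.
Let p_gt0 : (0 < p)%N. Proof. exact: ltnW. Qed.

(** If [a * u ^ p = x ^ p - x], then [a - (x / u) ^ p = - x / u ^ p]. The bound
    [v u < - v a] makes the left-hand side of negative value, so that
    [p * v x = v a + p * v u]; thus [x] has roughly the value of [u] and
    [x / u ^ p] is small when [v u] is very negative, contradicting that [a] is
    far from the [p]-th powers. *)
Lemma artin_schreier_approx a g u :
  (forall x, ~~ vgt v g (a - x ^+ p)) ->
  v u < 0 -> v u < - v a -> v u < v a - g *+ p -> u != 0 ->
  ~ artin_schreier p (a * u ^+ p).
Proof.
move=> far u_neg u_a u_g u0 [x e].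
have a0 : a != 0.
  have := far 0; rewrite (char_expr0 charKp) subr0.
  by apply: contraNneq => ->; apply: vgt0.
have up0 : u ^+ p != 0 by rewrite expf_neq0.
have aup0 : a * u ^+ p != 0 by rewrite mulf_neq0.
have x0 : x != 0.
  by apply: contraNneq aup0 => x0; rewrite e x0 (char_expr0 charKp) subrr.
have vaup : v (a * u ^+ p) = v a + v u *+ p by rewrite v_mul // v_exp.
have pu_le : v u *+ p <= v u by apply: (@oag_neg_leMn _ 1 p) p_gt0; apply: ltW.
(* An integral x would make x ^ p - x integral. *)
have [vx|] := boolP (0 <= v x).
  have : vge v 0 (x ^+ p - x).
    apply: vgeD; last by rewrite /vge vN vx orbT.
    rewrite /vge v_exp //; apply/orP; right.
    by have := oag_leMn p vx; rewrite mul0rn.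
  rewrite -e /vge (negPf aup0) /= vaup oag_leNgt => /negP; apply.
  apply: le_lt_trans (_ : v a + v u < 0); first by rewrite oag_leD2lE.
  by rewrite -(subrr (v a)) oag_ltD2lE.
rewrite -oag_ltNge => vx.
have vpx : v x *+ p = v a + v u *+ p.
  rewrite -vaup e -v_exp //; apply/esym.
  have xp0 : x ^+ p != 0 by rewrite expf_neq0.
  apply: (v_close xp0 _).2; rewrite addrC addKr vgtN /vgt (negPf x0) v_exp //=.
  exact: (@oag_neg_ltMn _ 1 p).
have := far (x / u).
have -> : a - (x / u) ^+ p = - (x / u ^+ p).
  rewrite expr_div_n -[a in LHS](mulfK up0) e -mulrBl addrAC subrr sub0r.
  by rewrite mulNr.
rewrite vgtN => /vgtNP[_]; rewrite v_mul ?invr_eq0 // vinv // v_exp //.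
(* Multiplied by p, the inequality v x - p v u <= g reads
   v a - p g <= (p ^ 2 - p) v u, and the right-hand side is at most v u. *)
set D := v u *+ (p * p - p).
have E : v u *+ (p * p) = v u *+ p + D.
  by rewrite -mulrnDr subnKC // -[leqLHS]muln1 leq_mul2l ltnW ?orbT.
move=> /(oag_leMn p); rewrite mulrnDl vpx mulNrn -mulrnA E opprD addrA addrK.
move=> /(oag_leD2l _ _ (D - g *+ p)); rewrite addrA subrK.
have -> : D - g *+ p + v a - D = v a - g *+ p.
  by rewrite addrAC [D + _]addrC addrK addrC.
apply/negP; rewrite -oag_ltNge; apply: le_lt_trans u_g.
apply: (@oag_neg_leMn _ 1); first exact: ltW.
by rewrite subn_gt0 -[ltnLHS]muln1 ltn_mul2l p_gt0.
Qed.

End Characteristic.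

End Valuations.

(** If [a] stays away from the [p]-th powers, the elements
    [a * (y ^ (j + 1)) ^ p] with [v y] very negative lie in distinct classes
    modulo the Artin-Schreier image: the difference of two of them is
    [a * u ^ p] with [v u <= v y]. The same [y] serves as the element whose
    iterated [p]-th powers are distinct. *)
Theorem NTP2_dense_powers (K : fieldType) (G : oagType) (v : valuation K G) p :
  p \in [pchar K] -> nontrivial_valuation v -> definable_in_NTP2 K ->
  forall a g, exists x, vgt v g (a - x ^+ p).
Proof.
move=> charKp [z0 z0_neq0 vz0] K_NTP2 a g.
apply: contrapT => /forallNP far.
have {}far x : ~~ vgt v g (a - x ^+ p) by apply/negP/far.
have [d [d0 da dg]] : exists d, [/\ d < 0, d < - v a & d < v a - g *+ p].
  have [e e0] : exists e : G, e < 0.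
    have [le0|] := boolP (v z0 <= 0).
      by exists (v z0); rewrite lt_neqAle vz0.
    rewrite -oag_ltNge => lt0; exists (- v z0).
    by rewrite -(oag_ltD2lE (v z0)) subrr addr0.
  have [m1 [m1l m1r]] := oag_ge_exists 0 (v a).
  have [m2 [m2l m2r]] := oag_ge_exists m1 (g *+ p - v a).
  have lt x : - x <= m2 -> e - m2 < x.
    move=> xm; rewrite addrC -[x]opprK -[ltRHS]addr0.
    apply: oag_le_ltD => //; rewrite -(oag_leD2lE m2) subrr.
    by rewrite -(oag_leD2lE (- x)) addrCA subrr !addr0.
  exists (e - m2); split; apply: lt.
  - by rewrite oppr0 (le_trans m1l).
  - by rewrite opprK (le_trans m1r).
  - by rewrite opprB.
have [y y0 vy] := v_onto v d.
have vyn k : v (y ^+ k) = d *+ k by rewrite v_exp // vy.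
pose r j := a * (y ^+ j.+1) ^+ p.
have diff i j : (i < j)%N -> ~ artin_schreier p (r i - r j).
  move=> ij; rewrite /r -mulrBr -(char_exprB charKp).
  have yj0 : - y ^+ j.+1 != 0 by rewrite oppr_eq0 expf_neq0.
  have [u0 vu] : y ^+ i.+1 - y ^+ j.+1 != 0 /\
      v (y ^+ i.+1 - y ^+ j.+1) = d *+ j.+1.
    rewrite -vyn -[RHS](vN v); apply: v_close => //.
    by rewrite opprK subrK vN vyn /vgt expf_eq0 (negPf y0) /= vyn oag_neg_ltMn.
  have ud : v (y ^+ i.+1 - y ^+ j.+1) <= d.
    by rewrite vu; apply: (@oag_neg_leMn _ 1) => //; apply: ltW.
  by apply: (artin_schreier_approx charKp far) => //; apply: le_lt_trans ud _.
apply: (@NTP2_artin_schreier_classes K p y r K_NTP2 charKp) => [k l|i j] /=.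
  move=> /(congr1 v); rewrite !vyn => e; apply/eqP.
  rewrite -(eqn_exp2l _ _ (prime_gt1 (pcharf_prime charKp))).
  by case: ltngtP => // lt; have := oag_neg_ltMn d0 lt; rewrite e ltxx.
move=> AS; case: (ltngtP i j) => // lt.
  by case: (diff _ _ lt).
case: (diff _ _ lt); rewrite -opprB -sub0r; apply: artin_schreierB => //.
by exists 0; rewrite (char_expr0 charKp) subrr.
Qed.

Lemma dense_powers_divisible (K : fieldType) (G : oagType)
    (v : valuation K G) p :
  (0 < p)%N -> (forall a g, exists x, vgt v g (a - x ^+ p)) -> DRst G p.
Proof.
move=> p0 dense g; have [a a0 va] := v_onto v g.
have [x] := dense a g; rewrite vgtBC -va => /(v_close a0) [xp0].
have x0 : x != 0 by apply: contraNneq xp0 => ->; rewrite expr0n gtn_eqF.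
by rewrite v_exp // => <-; exists (v x).
Qed.

(** * Completion of a valued field *)

Section Completion.
Variables (K : fieldType) (G : oagType) (v : valuation K G).
Implicit Types g h : G.

Local Notation E := (@oag_infty G).

Definition cauchy (s : G -> K) :=
  forall g, exists x, E [set k | vgt v g (s k - x)].
Definition null (s : G -> K) := forall g, E [set k | vgt v g (s k)].

Lemma cauchy_pair s : cauchy s ->
  forall g, exists2 A, E A & forall k l, A k -> A l -> vgt v g (s k - s l).
Proof.
move=> cs g; have [x Ex] := cs g; exists [set k | vgt v g (s k - x)] => //.
by move=> k l /= kx lx; apply: vgt_trans kx _; rewrite vgtBC.
Qed.

Lemma cauchy_bounded s : cauchy s ->
  exists b, E [set k | vge v b (s k)].
Proof.
move=> cs; have [A EA HA] := cauchy_pair cs 0.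
have [l Al] := filter_ex EA.
exists (if v (s l) <= 0 then v (s l) else 0); apply: filterS EA => k Ak.
rewrite /= -(subrK (s l) (s k)); apply: vgeD.
  by apply/vgt_vge/vgt_le/(HA _ _ Ak Al); case: ifP.
rewrite /vge; apply/orP; right; case: ifPn => //.
by rewrite -oag_ltNge => /ltW.
Qed.

Definition is_cauchy_net : {pred G -> K} :=
  fun s => `[< cauchy s >].

Lemma is_cauchy_net_closed : subring_closed is_cauchy_net.
Proof.
split.
- apply/asboolP => g; exists 1; apply: filterS filterT => k _ /=.
  by rewrite subrr vgt0.
- move=> s t /asboolP cs /asboolP ct; apply/asboolP => g.
  have [x Ex] := cs g; have [y Ey] := ct g; exists (x - y).
  apply: filterS2 Ex Ey => k /= sx ty.
  have -> : (s - t) k - (x - y) = (s k - x) - (t k - y).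
    by rewrite !opprD !opprK [RHS]addrACA.
  exact: vgtB.
- move=> s t /asboolP cs /asboolP ct; apply/asboolP => g.
  have [b Eb] := cauchy_bounded cs; have [c Ec] := cauchy_bounded ct.
  have [A EA HA] := cauchy_pair cs (g - c).
  have [B EB HB] := cauchy_pair ct (g - b).
  have EX : E (([set k | vge v b (s k)] `&` [set k | vge v c (t k)]) `&`
      (A `&` B)).
    by do 2?apply: filterI.
  have [l [[_ cl] [Al Bl]]] := filter_ex EX.
  exists (s l * t l); apply: filterS EX => k [[bk _] [Ak Bk]] /=.
   have -> : (s * t) k - s l * t l = s k * (t k - t l) + t l * (s k - s l).
    by rewrite !mulrBr ![t l * _]mulrC addrA subrK.
  apply: vgtD.
  - by rewrite -[g](subrK b) addrC; apply: vge_vgtM; [exact: bk|exact: HB].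
  - by rewrite -[g](subrK c) addrC; apply: vge_vgtM; [exact: cl|exact: HA].
Qed.

HB.instance Definition _ :=
  GRing.isSubringClosed.Build (G -> K) is_cauchy_net is_cauchy_net_closed.

Record cauchy_net := CauchyNet {
  cauchy_net_fun :> G -> K;
  _ : cauchy_net_fun \in is_cauchy_net }.

HB.instance Definition _ := [isSub for cauchy_net_fun].
HB.instance Definition _ := [Choice of cauchy_net by <:].
HB.instance Definition _ := GRing.SubChoice_isSubComPzRing.Build
  (G -> K) is_cauchy_net cauchy_net is_cauchy_net_closed.

Lemma cauchy_net1_neq0 : (1 : cauchy_net) != 0.
Proof.
by apply/eqP => /(congr1 (fun s : cauchy_net => s 0)) /eqP; rewrite oner_eq0.
Qed.

HB.instance Definition _ :=
  GRing.PzSemiRing_isNonZero.Build cauchy_net cauchy_net1_neq0.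

Definition is_null_net : {pred cauchy_net} := fun s => `[< null s >].

Lemma is_null_net_closed : idealr_closed is_null_net.
Proof.
split.
- by apply/asboolP => g; apply: filterS filterT => k _ /=; apply: vgt0.
- apply/asboolP => /(_ 0) /filter_ex [k].
  by rewrite /= /vgt oner_eq0 v1 ltxx.
- move=> a s t /asboolP ns /asboolP nt; apply/asboolP => g.
  have [b Eb] := cauchy_bounded (asboolP _ (valP a)).
  apply: filterS2 Eb (filterI (ns (g - b)) (nt g)) => k bk [/= sk tk].
  apply: vgtD tk; rewrite -[g](subrK b) addrC.
  exact: vge_vgtM.
Qed.

HB.instance Definition _ :=
  isIdealr.Build cauchy_net is_null_net is_null_net_closed.

(** Nets indexed by [G] suffice to be complete for arbitrary Cauchy filters,
    since the balls around a point are themselves indexed by [G]. *)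
Definition completion := {ideal_quot is_null_net}.

Local Notation proj := (\pi_{ideal_quot is_null_net}).

HB.instance Definition _ := GRing.ComNzRing.on completion.

Definition has_value (s : G -> K) g := E [set k | s k != 0 /\ v (s k) = g].

(** Once the terms are within [g] of each other and one of them has value at
    most [g], all later terms have its value. *)
Lemma has_value_exists (s : cauchy_net) : s \notin is_null_net ->
  exists g, has_value s g.
Proof.
move=> /asboolPn /existsNP [g ng].
have [A EA HA] := cauchy_pair (asboolP _ (valP s)) g.
have [l Al] := filter_ex EA.
have far : ~~ vgt v g (s l).
  apply/negP => gl; apply: ng; apply: filterS EA => k Ak /=.
  by rewrite -(subrK (s l) (s k)); apply: vgtD gl; apply: HA.
have [sl0 vsl] := vgtNP far.
exists (v (s l)); apply: filterS EA => k Ak; apply: v_close => //.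
by apply: vgt_le vsl _; apply: HA.
Qed.

Definition net_inv (s : cauchy_net) : cauchy_net :=
  insubd (0 : cauchy_net) (fun k => (s k)^-1).

(** The terms eventually have a constant value [d], and
    [1 / x - 1 / y = (y - x) / (x * y)] then loses only [2 * d] of closeness. *)
Lemma net_invE (s : cauchy_net) : s \notin is_null_net ->
  net_inv s = (fun k => (s k)^-1) :> (G -> K).
Proof.
move=> /has_value_exists [d Ed]; rewrite [LHS]val_insubd.
suff -> : (fun k => (s k)^-1) \in is_cauchy_net by [].
apply/asboolP => g.
have [A EA HA] := cauchy_pair (asboolP _ (valP s)) (g + d + d).
have [l [[sl0 vl] Al]] := filter_ex (filterI Ed EA).
exists (s l)^-1; apply: filterS2 Ed EA => k [sk0 vk] Ak /=.
have -> : (s k)^-1 - (s l)^-1 = (s k)^-1 * ((s l)^-1 * (s l - s k)).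
  by rewrite !mulrBr mulVf // [(s l)^-1 * _]mulrC mulrA mulVf // mul1r mulr1.
have vge_inv m : s m != 0 -> v (s m) = d -> vge v (- d) (s m)^-1.
  by move=> sm0 vm; rewrite /vge vinv // vm lexx orbT.
have -> : g = - d + (- d + (g + d + d)).
  by rewrite [_ + d]addrC addKr addrC addrK.
by do 2!(apply: vge_vgtM; first exact: vge_inv); apply: HA.
Qed.

Lemma proj_eq0 (s : cauchy_net) :
  (proj s == 0 :> completion) = (s \in is_null_net).
Proof. by rewrite -[s in RHS]subr0 Quotient.idealrBE rmorph0. Qed.

Definition completion_inv (x : completion) : completion :=
  if x == 0 then 0 else proj (net_inv (repr x)).

Lemma completion_mulVf (x : completion) : x != 0 -> completion_inv x * x = 1.
Proof.
move=> x0; rewrite /completion_inv (negPf x0) -{2}[x]reprK -rmorphM.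
have s0 : repr x \notin is_null_net by rewrite -proj_eq0 reprK.
apply/eqP; rewrite -(rmorph1 proj) -Quotient.idealrBE; apply/asboolP => g.
have [d Ed] := has_value_exists s0; apply: filterS Ed => k [sk0 _].
change (vgt v g (net_inv (repr x) k * repr x k - 1)).
by rewrite net_invE // mulVf // subrr vgt0.
Qed.

Lemma completion_inv0 : completion_inv 0 = 0.
Proof. by rewrite /completion_inv eqxx. Qed.

HB.instance Definition _ := GRing.ComNzRing_isField.Build completion
  completion_mulVf completion_inv0.

Definition completion_v (x : completion) : G := xget 0 (has_value (repr x)).

Lemma has_value_inj s g h : has_value s g -> has_value s h -> g = h.
Proof. by move=> sg /(filterI sg) /filter_ex [k [[_ <-] [_ <-]]]. Qed.

Lemma has_value_close (s t : G -> K) g : null (t - s) -> has_value s g ->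
  has_value t g.
Proof.
move=> /(_ g) ts; apply: filterS2 ts => k /= ts [sk0 vk].
by rewrite -vk in ts *; apply: v_close.
Qed.

(** The eventual value, and whether there is one, does not depend on the net
    chosen to represent an element of the completion. *)
Lemma has_value_proj (s : cauchy_net) g :
  has_value s g <-> proj s != 0 :> completion /\ completion_v (proj s) = g.
Proof.
pose t : cauchy_net := repr (proj s : completion).
have ts : null (t - s).
  have := Quotient.idealrBE is_null_net t s.
  by rewrite reprK eqxx => /asboolP.
have st : null (s - t).
  by move=> h; apply: filterS (ts h) => k; rewrite /= vgtBC.
have N h : has_value s h -> proj s != 0 :> completion.
  move=> sh; rewrite proj_eq0; apply/negP => /asboolP /(_ h) /(filterI sh).
  by move=> /filter_ex [k [[sk0 <-]]]; rewrite /= /vgt (negPf sk0) ltxx.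
have vE h : has_value s h -> completion_v (proj s) = h.
  move=> sh; apply: (@has_value_inj t); last exact: has_value_close sh.
  by rewrite /completion_v; apply: xgetPex; exists h; apply: has_value_close sh.
split=> [sg|[s0 <-]]; first by split; [exact: N sg|exact: vE].
rewrite proj_eq0 in s0; have [h sh] := has_value_exists s0.
by rewrite (vE h).
Qed.

Lemma completion_v_ev (s : cauchy_net) : proj s != 0 :> completion ->
  has_value s (completion_v (proj s)).
Proof. by move=> s0; apply/has_value_proj. Qed.

Lemma const_net_proof (x : K) : (fun=> x) \in is_cauchy_net.
Proof.
apply/asboolP => g; exists x; apply: filterS filterT => k _ /=.
by rewrite subrr vgt0.
Qed.

Definition const_net x := CauchyNet (const_net_proof x).

Lemma has_value_const x : x != 0 -> has_value (const_net x) (v x).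
Proof. by move=> x0; apply: filterS filterT. Qed.

Lemma completion_v_onto g : exists2 x, x != 0 & completion_v x = g.
Proof.
have [x x0 vx] := v_onto v g.
have /has_value_proj[] := has_value_const x0.
by rewrite vx; exists (proj (const_net x)).
Qed.

Lemma completion_v_mul (x y : completion) : x != 0 -> y != 0 ->
  completion_v (x * y) = completion_v x + completion_v y.
Proof.
rewrite -[x]reprK -[y]reprK => /completion_v_ev vs /completion_v_ev vt.
rewrite -rmorphM; suff /has_value_proj[] : has_value (repr x * repr y)
    (completion_v (proj (repr x)) + completion_v (proj (repr y))) by [].
apply: filterS2 vs vt => k [s0 <-] [t0 <-].
by split; [apply: mulf_neq0|apply: v_mul].
Qed.

Lemma completion_v_add (x y : completion) : x != 0 -> y != 0 -> x + y != 0 ->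
  Order.min (completion_v x) (completion_v y) <= completion_v (x + y).
Proof.
rewrite -[x]reprK -[y]reprK => /completion_v_ev vs /completion_v_ev vt.
rewrite -rmorphD => /completion_v_ev vst.
have [k [[s0 <-] [[t0 <-] [st0 <-]]]] :=
  filter_ex (filterI vs (filterI vt vst)).
exact: v_add.
Qed.

Definition completion_valuation : valuation completion G :=
  Valuation completion_v_onto completion_v_mul completion_v_add.

Lemma vgt_proj (s : cauchy_net) g :
  E [set k | vgt v g (s k)] -> vgt completion_valuation g (proj s).
Proof.
move=> Es; rewrite /vgt; have [//|s0] := eqVneq (proj s : completion) 0.
have [k [sk [sk0 vk]]] := filter_ex (filterI Es (completion_v_ev s0)).
rewrite -[completion_valuation _]/(completion_v _) -vk.
by move: sk; rewrite /= /vgt (negPf sk0).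
Qed.

Definition to_completion (x : K) : completion := proj (const_net x).

Lemma const_net_zmod : zmod_morphism const_net.
Proof. by move=> x y; apply: val_inj. Qed.

Lemma const_net_monoid : monoid_morphism const_net.
Proof. by split=> [|x y]; apply: val_inj. Qed.

HB.instance Definition _ :=
  GRing.isZmodMorphism.Build K cauchy_net const_net const_net_zmod.
HB.instance Definition _ :=
  GRing.isMonoidMorphism.Build K cauchy_net const_net const_net_monoid.

Lemma to_completion_zmod : zmod_morphism to_completion.
Proof. by move=> x y; rewrite /to_completion !rmorphB. Qed.

Lemma to_completion_monoid : monoid_morphism to_completion.
Proof.
by rewrite /to_completion; split=> [|x y]; rewrite ?rmorph1 ?rmorphM.
Qed.

HB.instance Definition _ :=
  GRing.isZmodMorphism.Build K completion to_completion to_completion_zmod.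
HB.instance Definition _ :=
  GRing.isMonoidMorphism.Build K completion to_completion to_completion_monoid.

Lemma vgt_to_completion g x :
  vgt completion_valuation g (to_completion x) = vgt v g x.
Proof.
rewrite /vgt fmorph_eq0; have [//|x0] := eqVneq x 0.
by have /has_value_proj[_ <-] := has_value_const x0.
Qed.

Lemma completion_dense g (y : completion) :
  exists x, vball completion_valuation g y (to_completion x).
Proof.
rewrite -[y]reprK; set s : cauchy_net := repr y.
have [A EA HA] := cauchy_pair (asboolP _ (valP s)) g.
have [l Al] := filter_ex EA; exists (s l).
rewrite /vball /mkset /to_completion -rmorphB; apply: vgt_proj.
by apply: filterS EA => k Ak; apply: (HA l k).
Qed.

(** For a Cauchy filter [F], let [a g] be an element of [K] such that [F]
    contains the ball of radius [g] around it; the net [a] is Cauchy because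
    two such balls meet, and its class is the limit of [F]. *)
Lemma completion_is_completion :
  is_completion v completion_valuation to_completion.
Proof.
split.
- by move=> x /has_value_const /has_value_proj[].
- exact: completion_dense.
- move=> F PF cF.
  have /choice [a Ha] : forall g, exists a,
      F (vball completion_valuation g (to_completion a)).
    move=> g; have [x Fx] := cF g; have [a xa] := completion_dense g x.
    exists a; apply: filterS Fx => y xy; rewrite /vball /mkset.
    by apply: vgt_trans xy _; rewrite vgtBC.
  have close g k : g <= k -> vgt v g (a k - a g).
    move=> gk; have [y [yk yg]] := filter_ex (filterI (Ha k) (Ha g)).
    rewrite -vgt_to_completion rmorphB.
    by apply: vgt_trans (yg : vgt _ _ _); rewrite vgtBC; apply: vgt_le yk.
  have ca : a \in is_cauchy_net.
    by apply/asboolP => g; exists (a g); exists g => k; apply: close.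
  exists (proj (CauchyNet ca)) => g; apply: filterS (Ha g) => y ya.
  apply: vgt_trans (ya : vgt _ _ _) _; rewrite /to_completion -rmorphB.
  by apply: vgt_proj; exists g => k gk; rewrite /= vgtBC; apply: close.
Qed.

End Completion.

(** * Density of powers and the semitame property *)

(** Let [b g] be a [p]-th root, in [K], of an approximation of [y]. Since
    [x |-> x ^ p] is additive and multiplies values by [p], the net of the
    [b g] is Cauchy, and its limit is a [p]-th root of [y]. *)
Lemma completion_has_roots (K Kc : fieldType) (G : oagType) (v : valuation K G)
    (vc : valuation Kc G) (i : {rmorphism K -> Kc}) p :
  p \in [pchar K] -> is_completion v vc i ->
  (forall a g, exists x, vgt v g (a - x ^+ p)) ->
  forall y : Kc, exists x, y = x ^+ p.
Proof.
move=> charKp [vi dense_i complete_vc] dense y.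
have p_gt0 : (0 < p)%N by apply/prime_gt0/pcharf_prime/charKp.
have charKcp : p \in [pchar Kc] by rewrite (fmorph_pchar i).
have vgt_i g x : vgt vc g (i x) = vgt v g x.
  by rewrite /vgt fmorph_eq0; have [//|x0] := eqVneq x 0; rewrite vi.
have /choice [b Hb] : forall g, exists b, vgt vc (g *+ p) (i b ^+ p - y).
  move=> g; have [a ya] := dense_i (g *+ p) y.
  have [b ab] := dense a (g *+ p); exists b.
  apply: vgt_trans _ (ya : vgt _ _ _).
  by rewrite -rmorphXn -rmorphB vgt_i vgtBC.
have cauchy_b : cauchy_filter vc ((i \o b) @ @oag_infty G).
  move=> g; exists (i (b g)); exists g => k gk; rewrite /= /vball /mkset.
  rewrite -(vgt_exp vc _ _ p_gt0) (char_exprB charKcp).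
  apply: (vgt_trans (y := y)); first exact: vgt_le (oag_leMn p gk) (Hb k).
  by rewrite vgtBC.
have [x Hx] := complete_vc _ _ cauchy_b.
exists x; apply/eqP; rewrite -subr_eq0; apply/eqP/(@vgt_eq0 _ _ vc) => g g0.
(* Only g >= 0 matters, and there closeness p g implies closeness g. *)
have Exg : oag_infty [set k | vgt vc g (i (b k) - x)] := Hx g.
have [k [kx gk]] := filter_ex (filterI Exg (oag_infty_ge g)).
have le_gp : g <= g *+ p.
  rewrite -(prednK p_gt0) mulrS -[leLHS]addr0 oag_leD2lE.
  by have := oag_leMn p.-1 g0; rewrite mul0rn.
apply: (vgt_trans (y := i (b k) ^+ p)).
  by rewrite vgtBC; apply: vgt_le (Hb k); apply/(le_trans le_gp)/oag_leMn.
by apply: vgt_le le_gp _; rewrite -(char_exprB charKcp) vgt_exp.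
Qed.

Lemma char_dense_semitame (K : fieldType) (G : oagType) (v : valuation K G) p :
  p \in [pchar K] -> (forall a g, exists x, vgt v g (a - x ^+ p)) ->
  semitame v.
Proof.
move=> charKp dense; right; exists p.
have p_gt0 : (0 < p)%N by apply/prime_gt0/pcharf_prime/charKp.
split; first 1 last.
- exact: (dense_powers_divisible p_gt0 dense).
- exists (completion v), (completion_valuation v), (@to_completion _ _ v).
  have compl := completion_is_completion v.
  have roots := completion_has_roots charKp compl dense.
  split=> // x; have [y xy] := roots (val x).
  have y_int : y \in in_vring (completion_valuation v).
    have : vge (completion_valuation v) (0 *+ p) (y ^+ p).
      by rewrite mul0rn -xy; apply: (valP x).
    by rewrite vge_exp.
  exists (VRing y_int), 0.
  rewrite mulr0; apply/eqP; rewrite subr_eq0; apply/eqP.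
  by apply: val_inj; rewrite rmorphXn.
- have p0 : p%:R = 0 :> vring v.
    apply: val_inj.
    by rewrite [LHS](rmorph_nat \val p) (pcharf0 charKp) [RHS]rmorph0.
  rewrite inE (pcharf_prime charKp).
  have -> : p%:R = \pi_{ideal_quot (@in_vmax _ _ v)} p%:R :> residue_field v.
    by rewrite rmorph_nat.
  by rewrite p0 rmorph0 eqxx.
Qed.

Theorem corollary1p2 (K : fieldType) (G : oagType) (v : valuation K G) :
  (exists p : nat, p \in [pchar K]) ->
  nontrivial_valuation v ->
  definable_in_NTP2 K ->
  semitame v.
Proof.
move=> [p charKp] v_nontrivial K_NTP2.
apply: (char_dense_semitame charKp).
exact: (NTP2_dense_powers charKp v_nontrivial K_NTP2).
Qed.
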